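(* For every $n\ge 1$ there is a metric space homeomorphic to the standard Sierpi\'nski space $\mathscr{S}_n$ of topological dimension $n$ which is quasisymmetrically co-Hopfian.
   Context: A homeomorphism $f:(X,d_X)\to(Y,d_Y)$ between metric spaces is quasisymmetric (QS) if there is an increasing function $\eta:[0,\infty)\to[0,\infty)$ such that $\frac{d_Y(f(x),f(y))}{d_Y(f(y),f(z))}\le \eta\left(\frac{d_X(x,y)}{d_X(y,z)}\right)$ for all triples of distinct points $x,y,z\in X$. A quasisymmetric embedding is a quasisymmetric homeomorphism onto its image. A metric space $X$ is quasisymmetrically (QS) co-Hopfian if every quasisymmetric embedding of $X$ into itself is onto. The standard Sierpi\'nski space $\mathscr{S}_{n}\subset\mathbb{R}^{n+1}$ of topological dimension $n$ is $\mathscr{S}_n=\bigcap_{i\ge 0}F_i$, where $F_0=[0,1]^{n+1}$ and $F_{i+1}$ is obtained from $F_i$ (a union of triadic cubes of side length $3^{-i}$) by dividing each of these cubes into $3^{n+1}$ congruent subcubes of side length $3^{-i-1}$ and removing the open central subcube. *)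

(* Defs.v *)
From HB Require Import structures.
From mathcomp Require Import all_boot all_order all_algebra.
From mathcomp Require Import all_classical all_reals all_analysis.
Set Implicit Arguments.
Unset Strict Implicit.
Unset Printing Implicit Defensive.
Import Order.TTheory GRing.Theory Num.Theory.
Import numFieldNormedType.Exports.
Local Open Scope classical_set_scope.
Local Open Scope ring_scope.

(* [B] carries the subspace topology of [Y]: the values of [g] outside [B] are
   irrelevant, since {within B, continuous g} only constrains [g] on [B].
   For [B = setT] this is a homeomorphism from [X] to [Y]. *)
Definition homeomorphism_onto (X Y : topologicalType) (B : set Y)
    (f : X -> Y) : Prop :=
  [/\ set_bij [set: X] B f,
      continuous f &
      exists g : Y -> X, cancel f g /\ {within B, continuous g}].

Definition homeomorphic_to (X Y : topologicalType) (B : set Y) : Prop :=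
  exists f : X -> Y, homeomorphism_onto B f.

(* A map [0, oo) -> [0, oo) is represented by a map R -> R whose values at
   negative arguments are irrelevant. *)
Definition increasing_gauge (R : realType) (eta : R -> R) : Prop :=
  (forall t, 0 <= t -> 0 <= eta t) /\
  (forall s t, 0 <= s -> s < t -> eta s < eta t).

(* The target metric space is the subset [B] of [Y] with the restricted
   metric. *)
Definition quasisymmetric_onto (R : realType) (X Y : metricType R)
    (B : set Y) (f : X -> Y) : Prop :=
  homeomorphism_onto B f /\
  exists eta : R -> R, increasing_gauge eta /\
    forall x y z : X, x <> y -> y <> z -> x <> z ->
      mdist (f x) (f y) / mdist (f y) (f z)
        <= eta (mdist x y / mdist y z).

Definition quasisymmetric_embedding (R : realType) (X Y : metricType R)
    (f : X -> Y) : Prop :=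
  quasisymmetric_onto (range f) f.

Definition qs_coHopfian (R : realType) (X : metricType R) : Prop :=
  forall f : X -> X, quasisymmetric_embedding f -> range f = [set: X].

Definition closed_cube (R : realType) (m : nat) (a : 'rV[R]_m) (s : R) :
    set 'rV[R]_m :=
  [set x | forall j, a 0 j <= x 0 j <= a 0 j + s].

Definition open_cube (R : realType) (m : nat) (a : 'rV[R]_m) (s : R) :
    set 'rV[R]_m :=
  [set x | forall j, a 0 j < x 0 j < a 0 j + s].

(* The cubes of side 3^-i composing F_i, given by their lowest corners.
   A subcube of the cube with corner [a] is indexed by its ternary digits
   [d]; the central one has all digits equal to 1. *)
Fixpoint sierpinski_corners (R : realType) (m i : nat) : set 'rV[R]_m :=
  if i is i'.+1 then
    [set a + \row_j ((d j : nat)%:R / 3 ^+ i'.+1)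
      | a in @sierpinski_corners R m i'
      & d in [set d : {ffun 'I_m -> 'I_3} | exists j, (d j : nat) <> 1%N]]
  else [set 0].

Fixpoint sierpinski_stage (R : realType) (m i : nat) : set 'rV[R]_m :=
  if i is i'.+1 then
    @sierpinski_stage R m i' `\`
      \bigcup_(a in @sierpinski_corners R m i')
        open_cube (a + const_mx (3 ^- i'.+1)) (3 ^- i'.+1)
  else closed_cube 0 1.

(* The topology of 'rV[R]_(n.+1), defined by the sup norm, is the Euclidean
   one. *)
Definition sierpinski_space (R : realType) (n : nat) : set 'rV[R]_(n.+1) :=
  \bigcap_(i in [set: nat]) @sierpinski_stage R n.+1 i.
Arguments sierpinski_space R n : clear implicits.

(* Main.v *)
From HB Require Import structures.
Require Import Defs.
From mathcomp Require Import all_boot all_order all_algebra.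
From mathcomp Require Import all_classical all_reals all_analysis.
From mathcomp Require Import ring lra zify.
Import numFieldNormedType.Exports.

(** The Sierpinski space is given a metric inducing its topology for which every
quasisymmetric embedding into itself is the identity, hence onto.

The metric is the supremum over [i] of the norm distance modified near a centre
[c i]: in a ball of radius [N_i^-1], where [N_i = 2 ^ i!], the norm is magnified
by [N_i], but only up to distances comparable to [N_i^-1] ([bump_dist], [dist]).
Near its centre, bump [i] turns equally spaced points of a segment into an
almost equilateral set at scale [N_i^-1], with [N_i / N_(i-1)] points
([cluster_equilateral]).

A quasisymmetric embedding [f] sends such a set to a set that is equilateral up
to a constant, at some scale [r]. Applying the quasisymmetry inequality at ratio
2 along the doublings of a segment bounds [r] below by a power of [N_i^-1]
([power_law]); as [N_(i+1) = N_i ^ (i+1)], the bumps after [i] are too low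
to be seen at scale [r] when [i] is large. The bumps before [i] magnify at most
by [N_(i-1)], so they let a ball contain only a fixed power of [N_(i-1)] points
at mutual distances comparable to its radius ([packing]); this is less than
[N_i / N_(i-1)] for large [i]. So the image of the cluster has to meet bump [i]
itself. When [p] is the centre of infinitely many bumps, letting [i] tend to
infinity gives [f p = p] ([centre_fixed]).

It remains to take as centres, each infinitely often, a dense set of points from
which a segment of the space starts. The corners of the triadic cubes are such
points in topological dimension at least 1, because the edges of these cubes are
never removed ([edge_stage]). *)

Set Implicit Arguments.
Unset Strict Implicit.
Unset Printing Implicit Defensive.
Import Order.TTheory GRing.Theory Num.Theory.
Local Open Scope classical_set_scope.
Local Open Scope ring_scope.

(** * The bump metric *)

Section BumpMetric.
Context {R : realType} {V : normedModType R}.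
Variable c : nat -> V.
Implicit Types (x y z p w : V) (i I : nat).

(** The heights [(mag i)^-1] of successive bumps are separated beyond any
power, since [mag i.+1 = mag i ^+ i.+1]. This absorbs the power-law distortion
of scales by a quasisymmetric map, and makes [mag i.+1] eventually exceed every
fixed power of [mag i]. *)
Definition mag i : R := 2 ^+ i`!.

Lemma mag_gt0 i : 0 < mag i.
Proof. by rewrite /mag exprn_gt0. Qed.

Lemma mag_ge1 i : 1 <= mag i.
Proof. by rewrite /mag exprn_ege1// ler1n. Qed.

Lemma le_mag i I : (i <= I)%N -> mag i <= mag I.
Proof.
move=> iI; rewrite /mag ler_eXn2l ?ltr1n//.
apply: (homo_leq (r := leq)) iI => // [|n]; first exact: leq_trans.
by rewrite factS leq_pmull.
Qed.

Definition tent i x : R := Num.max 0 ((mag i)^-1 - `|x - c i|).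

Lemma tent_ge0 i x : 0 <= tent i x.
Proof. by rewrite /tent le_max lexx. Qed.

Lemma tent_le i x : tent i x <= (mag i)^-1.
Proof. by rewrite /tent ge_max invr_ge0 (ltW (mag_gt0 i)) gerBl normr_ge0. Qed.

Lemma tent_lip i x y : tent i x <= tent i y + `|x - y|.
Proof.
rewrite [leLHS]/tent ge_max addr_ge0 ?tent_ge0//=.
have : (mag i)^-1 - `|y - c i| <= tent i y by rewrite le_max lexx orbT.
have := ler_distD x y (c i); rewrite (distrC y x); lra.
Qed.

Lemma tent_eq0 i x : (mag i)^-1 <= `|x - c i| -> tent i x = 0.
Proof. by move=> h; rewrite /tent; apply/max_idPl; rewrite subr_le0. Qed.

(** Where the tents are positive the metric is magnified by [mag i], until
distances reach the height of the tents. The minimum is the norm scaled by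
[mag i] after the complement of the bump is collapsed to one point; the norm
is put back by the outer maximum. *)
Definition bump_dist i x y : R :=
  Num.max `|x - y| (Num.min (mag i * `|x - y|) (tent i x + tent i y)).

Lemma bump_distxx i x : bump_dist i x x = 0.
Proof.
rewrite /bump_dist subrr normr0 mulr0 min_l ?maxxx//.
by rewrite addr_ge0 ?tent_ge0.
Qed.

Lemma bump_distC i x y : bump_dist i x y = bump_dist i y x.
Proof. by rewrite /bump_dist distrC (addrC (tent i x)). Qed.

(** Collapsing keeps the triangle inequality because the tent is 1-Lipschitz,
hence also 1-Lipschitz for the magnified norm. *)
Lemma bump_dist_triangle i y x z :
  bump_dist i x z <= bump_dist i x y + bump_dist i y z.
Proof.
rewrite [leLHS]/bump_dist ge_max; apply/andP; split.
  by apply: le_trans (ler_distD y _ _) _; rewrite lerD// /bump_dist le_max lexx.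
rewrite ge_min.
have : Num.min (mag i * `|x - y|) (tent i x + tent i y) <= bump_dist i x y.
  by rewrite /bump_dist le_max lexx orbT.
have : Num.min (mag i * `|y - z|) (tent i y + tent i z) <= bump_dist i y z.
  by rewrite /bump_dist le_max lexx orbT.
have : mag i * `|x - z| <= mag i * `|x - y| + mag i * `|y - z|.
  by rewrite -mulrDr ler_pM2l ?mag_gt0// ler_distD.
have lip a b : tent i a <= tent i b + mag i * `|a - b|.
  by apply: le_trans (tent_lip _ _ b) _; rewrite lerD2l ler_peMl// mag_ge1.
move: (lip x y) (lip z y) (tent_ge0 i x) (tent_ge0 i y) (tent_ge0 i z).
rewrite (distrC z y).
case: (leP (mag i * `|x - y|)) => ?; case: (leP (mag i * `|y - z|)) => ? *;
  apply/orP; solve [left; lra | right; lra].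
Qed.

Lemma norm_le_bump_dist i x y : `|x - y| <= bump_dist i x y.
Proof. by rewrite /bump_dist le_max lexx. Qed.

Lemma bump_dist_le_mag i x y : bump_dist i x y <= mag i * `|x - y|.
Proof. by rewrite /bump_dist ge_max ge_min lexx ler_peMl// mag_ge1. Qed.

Lemma bump_dist_le_tent i x y :
  bump_dist i x y <= Num.max `|x - y| (tent i x + tent i y).
Proof.
rewrite /bump_dist ge_max !le_max lexx/= orbC; apply/orP; left.
by rewrite ge_min lexx orbT.
Qed.

Lemma bump_dist_le_inv i x y :
  bump_dist i x y <= Num.max `|x - y| (2 * (mag i)^-1).
Proof.
apply: le_trans (bump_dist_le_tent _ _ _) _.
rewrite ge_max !le_max lexx/= mulr2n mulrDl mul1r lerD ?tent_le//.
by rewrite orbT.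
Qed.

Definition dist x y : R := sup (range (fun i => bump_dist i x y)).

Lemma dist_le M x y : (forall i, bump_dist i x y <= M) -> dist x y <= M.
Proof.
move=> h; apply: ge_sup; first by exists (bump_dist 0 x y), 0%N.
by move=> _ [i _ <-].
Qed.

Lemma bump_dist_le i x y : bump_dist i x y <= dist x y.
Proof.
apply: ub_le_sup; last by exists i.
exists (Num.max `|x - y| 2) => _ [k _ <-].
apply: le_trans (bump_dist_le_inv _ _ _) _.
rewrite ge_max !le_max lexx/= orbC ger_pMr// invf_le1 ?mag_gt0//.
by rewrite mag_ge1.
Qed.

Lemma norm_le_dist x y : `|x - y| <= dist x y.
Proof. exact: le_trans (norm_le_bump_dist 0 _ _) (bump_dist_le _ _ _). Qed.

Lemma dist_ge0 x y : 0 <= dist x y.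
Proof. exact: le_trans (normr_ge0 _) (norm_le_dist _ _). Qed.

Lemma distxx x : dist x x = 0.
Proof.
apply/eqP; rewrite eq_le dist_le/=; last by move=> i; rewrite bump_distxx.
by rewrite -(bump_distxx 0 x) bump_dist_le.
Qed.

Lemma dist_positive x y : dist x y = 0 -> x = y.
Proof.
move=> d0; apply/eqP; rewrite -subr_eq0 -normr_le0 -d0.
exact: norm_le_dist.
Qed.

Lemma dist_sym x y : dist x y = dist y x.
Proof.
rewrite /dist (_ : (fun i => bump_dist i x y) = fun i => bump_dist i y x)//.
by apply/funext => i; exact: bump_distC.
Qed.

Lemma dist_triangle y x z : dist x z <= dist x y + dist y z.
Proof.
apply: dist_le => i; apply: le_trans (bump_dist_triangle i y _ _) _.
by rewrite lerD// bump_dist_le.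
Qed.

(** What the metric can see around the scale of bump [I.+1]: earlier bumps
magnify at most by [mag I], later ones are too low, so only bump [I.+1] itself
escapes a bound in terms of the norm. *)
Lemma dist_le_scales I x y : dist x y <=
  Num.max (mag I * `|x - y|)
    (Num.max (bump_dist I.+1 x y) (2 * (mag I.+2)^-1)).
Proof.
apply: dist_le => i; rewrite le_max [X in _ || X]le_max.
have nM : `|x - y| <= mag I * `|x - y| by rewrite ler_peMl// mag_ge1.
have [iI|] := leqP i I.
  apply/orP; left; apply: le_trans (bump_dist_le_mag _ _ _) _.
  by rewrite ler_wpM2r// le_mag.
rewrite leq_eqVlt => /predU1P[<-|Ii]; first by rewrite lexx orbT.
have := bump_dist_le_inv i x y; rewrite le_max => /orP[h|h].
  by rewrite (le_trans h nM).
apply/orP; right; apply/orP; right; apply: le_trans h _.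
by rewrite ler_pM2l// lef_pV2 ?posrE ?mag_gt0// le_mag.
Qed.

Lemma dist_le_scale I x y :
  dist x y <= Num.max (mag I * `|x - y|) (2 * (mag I.+1)^-1).
Proof.
apply: le_trans (dist_le_scales I _ _) _.
have nM : `|x - y| <= mag I * `|x - y| by rewrite ler_peMl// mag_ge1.
rewrite ge_max le_max lexx [X in _ && X]ge_max/=; apply/andP; split.
  apply: le_trans (bump_dist_le_inv _ _ _) _.
  by rewrite ge_max !le_max nM lexx orbT.
rewrite le_max; apply/orP; right.
by rewrite ler_pM2l// lef_pV2 ?posrE ?mag_gt0// le_mag.
Qed.

(** The magnified norm doubles with the segment, and along the added half a tent
grows by at most the length of that half, which the norm already dominates.
Distances at different scales are thus compared without any connectedness. *)
Lemma dist_double p w : dist p (p + 2 *: w) <= 2 * dist p (p + w).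
Proof.
have n1 : `|p - (p + w)| = `|w| by rewrite opprD addNKr normrN.
have n2 : `|p - (p + 2 *: w)| = 2 * `|w|.
  by rewrite opprD addNKr normrN normrZ ger0_norm.
apply: dist_le => i.
have := bump_dist_le i p (p + w).
rewrite /bump_dist n1 n2 ge_max ge_min => /andP[dn dm].
rewrite ge_max ge_min; apply/andP; split; first lra.
have tl : tent i (p + 2 *: w) <= tent i (p + w) + `|w|.
  apply: le_trans (tent_lip _ _ (p + w)) _.
  by rewrite opprD addrACA subrr add0r scaler_nat mulr2n addrK.
have := tent_ge0 i p; have := tent_ge0 i (p + w).
by move=> ? ?; case/orP: dm => dm; apply/orP; [left|right]; lra.
Qed.

End BumpMetric.

(** * Packing in the sup norm *)

Section Packing.
Context {R : realType} {m : nat}.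
Implicit Types v x : 'rV[R]_m.

Lemma entry_le_norm v j : `|v 0 j| <= `|v|.
Proof.
rewrite [leRHS]mx_normrE.
exact: (le_bigmax _ (fun ij : 'I_1 * 'I_m => `|v ij.1 ij.2|) (0, j)).
Qed.

Lemma norm_lt_entries v s : 0 < s -> (forall j, `|v 0 j| < s) -> `|v| < s.
Proof.
move=> s0 h; rewrite [ltLHS]mx_normrE; apply: bigmax_lt => //= -[i j] _ /=.
by rewrite ord1.
Qed.

Lemma norm_le_entries v s : 0 <= s -> (forall j, `|v 0 j| <= s) -> `|v| <= s.
Proof.
move=> s0 h; rewrite [leLHS]mx_normrE; apply: bigmax_le => //= -[i j] _ /=.
by rewrite ord1.
Qed.

(** Separated points fall in distinct cells of a grid of mesh [s]. *)
Lemma packing (A B : nat) (G : 'I_A -> 'rV[R]_m) x (rho s : R) :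
  0 < s -> 2 * rho < s * B.+1%:R ->
  (forall a, `|G a - x| <= rho) ->
  (forall a b, a != b -> s <= `|G a - G b|) -> (A <= B.+1 ^ m)%N.
Proof.
move=> s0 rhoB Gx Gs.
pose coord a j := (G a 0 j - x 0 j + rho) / s.
have c0 a j : 0 <= coord a j.
  rewrite divr_ge0 ?(ltW s0)//.
  have := entry_le_norm (G a - x) j; rewrite !mxE ler_norml => /andP[h _].
  by have := Gx a; lra.
have cB a j : (Num.truncn (coord a j) < B.+1)%N.
  rewrite truncn_lt_nat// ltr_pdivrMr//.
  have := entry_le_norm (G a - x) j; rewrite !mxE ler_norml => /andP[_ h].
  by have := Gx a; lra.
pose cell a : {ffun 'I_m -> 'I_B.+1} := [ffun j => Ordinal (cB a j)].
suff /leq_card : injective cell by rewrite card_ffun !card_ord.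
move=> a b /ffunP ab; apply/eqP; apply: contraT => /Gs.
rewrite leNgt norm_lt_entries// => j.
have := ab j; rewrite !ffunE => /(congr1 val)/= cab.
have := truncn_itv (c0 a j); have := truncn_itv (c0 b j).
rewrite cab; set k := Num.truncn _ => /andP[b1 b2] /andP[a1 a2].
have : `|coord a j - coord b j| < 1.
  by rewrite ltr_norml -natr1 in b2 a2 *; lra.
rewrite /coord -mulrBl normrM normfV (gtr0_norm s0) ltr_pdivrMr// mul1r.
by rewrite !mxE; congr (`|_| < s); lra.
Qed.

End Packing.

(** * Almost equilateral sets at the centre of a bump *)

Section Cluster.
Context {R : realType} {V : normedModType R}.
Variable c : nat -> V.

(** Equally spaced points so close to [p] that their spacing magnified by
[mag I.+1] is the height of that bump. *)
Definition cluster (p e : V) I (k : nat) : V := p + (k%:R / mag I.+1 ^+ 2) *: e.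

(** Bump [I.+1] pushes the points apart to its height. The points number
[mag I.+1 / mag I], so that they stay within [(mag I.+1 * mag I)^-1] of [p] and
the earlier bumps cannot separate them further. *)
Lemma cluster_equilateral (p e : V) I (a b : nat) : c I.+1 = p -> `|e| = 1 ->
  (a <= 2 ^ (I * I`!))%N -> (b <= 2 ^ (I * I`!))%N -> a <> b ->
  (mag I.+1)^-1 <= dist c (cluster p e I a) (cluster p e I b)
    <= 2 * (mag I.+1)^-1.
Proof.
move=> cp e1 aA bA ab; set y := cluster p e I.
set M : R := mag I; set N : R := mag I.+1.
have N0 : 0 < N by exact: mag_gt0.
have M0 : 0 < M by exact: mag_gt0.
have M2 : 2 <= M by rewrite /M /mag -[leLHS]expr1 ler_weXn2l ?ler1n ?fact_gt0.
have NE : N = M * (2 ^ (I * I`!))%:R.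
  by rewrite /N /M /mag factS mulSn exprD natrX.
set A : R := (2 ^ (I * I`!))%:R in NE.
have aAR : a%:R <= A by rewrite /A ler_nat.
have bAR : b%:R <= A by rewrite /A ler_nat.
have yy : `|y a - y b| = `|a%:R - b%:R| / N ^+ 2.
  rewrite /y /cluster opprD addrACA subrr add0r -scalerBl normrZ.
  rewrite e1 mulr1 -mulrBl.
  by rewrite normrM normfV (gtr0_norm (exprn_gt0 _ N0)).
have ab1 : 1 <= `|a%:R - b%:R : R|.
  have [lt|lt|//] := ltngtP a b; move: lt; rewrite -(ler_nat R) -natr1 => h;
    rewrite ler_normr; apply/orP; [right|left]; lra.
have abA : `|a%:R - b%:R| <= A.
  have := ler0n R a; have := ler0n R b; rewrite ler_norml; lra.
have yp (k : nat) : k%:R <= A -> N^-1 / 2 <= tent c I.+1 (y k).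
  move=> kA; rewrite /tent cp /y /cluster addrAC subrr add0r normrZ e1 mulr1.
  rewrite le_max; apply/orP; right.
  rewrite ger0_norm ?divr_ge0 ?(ltW (exprn_gt0 _ N0))// -/N.
  have : k%:R / N ^+ 2 <= N^-1 / 2.
    rewrite expr2 invfM mulrCA ler_pM2l ?invr_gt0//.
    rewrite ler_pdivrMr// NE; nra.
  lra.
apply/andP; split; last first.
  apply: le_trans (dist_le_scale c I _ _) _; rewrite ge_max lexx andbT yy.
  rewrite expr2 invfM -/M !mulrA ler_pM2r ?invr_gt0// ler_pdivrMr//.
  have : M * `|a%:R - b%:R| <= M * A by rewrite ler_pM2l.
  lra.
apply: le_trans (bump_dist_le c I.+1 _ _).
rewrite /bump_dist le_max; apply/orP; right; rewrite le_min; apply/andP; split.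
  rewrite yy -/N expr2 invfM mulrCA !mulrA mulfK ?gt_eqF//.
  by rewrite ler_peMl// invr_ge0 ltW.
by have := yp a aAR; have := yp b bAR; lra.
Qed.

End Cluster.

(** * Centres of infinitely many bumps are fixed *)

Lemma ex_small_pow2 (R : realType) (e : R) : 0 < e -> exists k, 2 ^- k <= e.
Proof.
move=> e0; exists (Num.truncn e^-1); rewrite -[leRHS]invrK.
rewrite lef_pV2 ?posrE ?exprn_gt0 ?invr_gt0//.
apply: le_trans (ltW (truncnS_gt _)) _.
by rewrite -natrX ler_nat ltn_expl.
Qed.

Lemma ler_pow2V (R : realType) (a b : nat) :
  (b <= a)%N -> 2 ^- a <= 2 ^- b :> R.
Proof. by move=> ba; rewrite lef_pV2 ?posrE ?exprn_gt0// ler_weXn2l ?ler1n. Qed.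

(** Here [F] stands for a quasisymmetric embedding read along a segment of
length [2 ^- l] issued from [p] in the direction [e]. *)
Section Centre.
Context {R : realType} {m : nat}.
Local Notation V := 'rV[R]_m.
Variables (c : nat -> V) (p e : V) (l k : nat) (F : R -> V).
Hypothesis e1 : `|e| = 1.
Hypothesis weak : forall s t u,
  0 <= s <= 2 ^- l -> 0 <= t <= 2 ^- l -> 0 <= u <= 2 ^- l ->
  dist c (p + s *: e) (p + t *: e) <= 2 * dist c (p + t *: e) (p + u *: e) ->
  dist c (F s) (F t) <= 2 ^+ k * dist c (F t) (F u).

Let itv0 : 0 <= (0 : R) <= 2 ^- l.
Proof. by rewrite lexx invr_ge0 exprn_ge0. Qed.

Let itvV j : (l <= j)%N -> 0 <= (2 ^- j : R) <= 2 ^- l.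
Proof. by move=> lj; rewrite invr_ge0 exprn_ge0//= ler_pow2V. Qed.

(** Each halving of the segment divides the distance between the images of its
ends by at most [2 ^+ k], so a scale is contracted at most to a power of it. *)
Lemma power_law j :
  dist c (F 0) (F (2 ^- l)) <= 2 ^+ (k * j) * dist c (F 0) (F (2 ^- (l + j))).
Proof.
elim: j => [|j IH]; first by rewrite addn0 muln0 expr0 mul1r.
apply: le_trans IH _; rewrite mulnSr (exprD _ (k * j)) -mulrA.
rewrite ler_pM2l ?exprn_gt0//.
rewrite dist_sym; apply: weak => //; [exact: itvV (leq_addr _ _)..|].
rewrite scale0r addr0 dist_sym.
have -> : 2 ^- (l + j) *: e = 2 *: (2 ^- (l + j.+1) *: e).
  by rewrite scalerA addnS exprS invfM mulVKf.
exact: dist_double.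
Qed.

Hypothesis inj : F 0 <> F (2 ^- l).
Hypothesis cont : forall eps, 0 < eps -> exists2 j, (l <= j)%N &
  forall i, (j <= i)%N -> dist c (F 0) (F (2 ^- i)) < eps.
Hypothesis often : forall J, exists2 I, (J <= I)%N & c I.+1 = p.

(** The image of the cluster at bump [I.+1] is again equilateral up to constants
depending only on [k], at a scale [r] which [power_law] bounds below, far above
the height of all bumps after [I.+1]. If [F 0] were not [p], bump [I.+1] would
not reach the image for large [I], as [r] tends to 0. Only the magnification
[mag I] of the earlier bumps would then be left to separate the image, so its
points would be [r / mag I]-separated in norm inside a ball of radius
comparable to [r], and their number [mag I.+1 / mag I] would be bounded by a
fixed power of [mag I]. *)
Lemma centre_fixed : F 0 = p.
Proof.
apply/eqP; apply: contraT => F0p.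
have [d0 d0E] : exists d0, 2 ^- d0 <= `|F 0 - p| / 2 :> R.
  by apply: ex_small_pow2; rewrite divr_gt0// normr_gt0 subr_eq0.
have [q qE] : exists q, 2 ^- q <= dist c (F 0) (F (2 ^- l)).
  apply: ex_small_pow2; rewrite lt_neqAle eq_sym.
  rewrite (le_trans (normr_ge0 _) (norm_le_dist _ _ _)) andbT.
  by apply/eqP => /dist_positive.
have [j lj jE] : exists2 j, (l <= j)%N &
    forall i, (j <= i)%N -> dist c (F 0) (F (2 ^- i)) < 2 ^- (d0 + k).
  by apply: cont; rewrite invr_gt0 exprn_gt0.
(* [j] makes [r] small, [d0] the bump low, [q] and [k] let [r] exceed the later
   bumps, and the last term defeats the packing bound. *)
have [I + cI] := often (l + d0 + j + q + 4 * k + 4 + (3 * k + 4) * m).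
set u := I`!; have u1 : (1 <= u)%N by exact: fact_gt0.
move=> JI.
pose w := (I.+1)`!; have wE : w = (u + I * u)%N by rewrite /w factS mulSn.
have NE : mag I.+1 = 2 ^+ w :> R by [].
pose N : R := mag I.+1.
pose A := (2 ^ (I * u))%N.
have N2 : N ^+ 2 = 2 ^+ (2 * w) by rewrite /N NE -exprM mulnC.
have Ilw : (I <= w)%N by nia.
pose G a := F (a%:R / N ^+ 2).
have G0 : G 0%N = F 0 by rewrite /G mul0r.
have G1 : G 1%N = F (2 ^- (2 * w)) by rewrite /G mul1r N2.
set r := dist c (F 0) (G 1%N).
have r_small : 2 ^+ k * r < 2 ^- d0.
  have := jE (2 * w)%N; rewrite -G1 -/r exprD invfM.
  have k0 : 0 < 2 ^+ k :> R by rewrite exprn_gt0.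
  rewrite mulrC => h; rewrite mulrC -ltr_pdivlMr// mulrC h//; lia.
have r_big : 2 ^- (q + k * (2 * w)) <= r.
  have := power_law (2 * w - l); rewrite subnKC; last lia.
  rewrite -G1 -/r => h.
  rewrite exprD invfM ler_pdivrMr ?exprn_gt0// mulrC.
  apply: le_trans qE _; apply: le_trans h _; rewrite ler_wpM2r//.
    exact: (le_trans (normr_ge0 _) (norm_le_dist _ _ _)).
  by rewrite ler_weXn2l ?ler1n// leq_mul2l leq_subr orbT.
have itvG (a : nat) : (a <= A)%N -> 0 <= a%:R / N ^+ 2 <= 2 ^- l.
  move=> aA; rewrite divr_ge0 ?N2 ?exprn_ge0//= ler_pdivrMr ?exprn_gt0//.
  have : a%:R <= A%:R :> R by rewrite ler_nat.
  move/le_trans; apply; rewrite /A natrX.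
  rewrite mulrC -expfB_cond// ?ler_weXn2l ?ler1n//; lia.
have eqlat a b : (a <= A)%N -> (b <= A)%N -> a <> b ->
   N^-1 <= dist c (cluster p e I a) (cluster p e I b) <= 2 * N^-1.
  by move=> *; apply: cluster_equilateral.
have wk a b d : (a <= A)%N -> (b <= A)%N -> (d <= A)%N -> b <> d ->
    dist c (G a) (G b) <= 2 ^+ k * dist c (G b) (G d).
  move=> aA bA dA bd; apply: weak; [exact: itvG..|].
  have /andP[lo _] := eqlat _ _ bA dA bd.
  have [->|/eqP ab] := eqVneq a b; first by rewrite distxx mulr_ge0 ?dist_ge0.
  have /andP[_ up] := eqlat _ _ aA bA ab.
  by apply: le_trans up _; rewrite ler_pM2l.
have A1 : (1 <= A)%N by rewrite expn_gt0.
have rE : r = dist c (G 1%N) (G 0%N) by rewrite /r -G0 dist_sym.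
have far a : (a <= A)%N -> dist c (F 0) (G a) <= 2 ^+ k * r.
  by move=> aA; rewrite rE dist_sym -G0 (dist_sym _ (G 1%N)); apply: wk.
(* The triples of indices (1, 0, a) and (0, a, b) are compared at ratio 2. *)
have sep a b : (0 < a <= A)%N -> (b <= A)%N -> a <> b ->
    r <= 2 ^+ (k + k) * dist c (G a) (G b).
  move=> /andP[a0 aA] bA ab; rewrite rE exprD -mulrA.
  apply: le_trans (wk 1%N 0%N a _ _ _ _) _ => //; first lia.
  by rewrite ler_pM2l ?exprn_gt0// wk.
have r0 : 0 < r by apply: lt_le_trans r_big; rewrite invr_gt0 exprn_gt0.
(* Both [2 ^+ k * r] and the height of bump [I.+1] are small against the norm
   of [F 0 - p], so that the image of the cluster lies outside this bump. *)
have notent a : (a <= A)%N -> tent c I.+1 (G a) = 0.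
  move=> aA; apply: tent_eq0; rewrite cI.
  have Nd : N^-1 <= 2 ^- d0 by rewrite /N NE ler_pow2V//; lia.
  have := ler_distD (G a) (F 0) p; have := norm_le_dist c (F 0) (G a).
  have := far _ aA; rewrite -/N; lra.
have sepE a b : (0 < a <= A)%N -> (0 < b <= A)%N -> a <> b ->
    r <= 2 ^+ (k + k + u) * `|G a - G b|.
  move=> aA /andP[b0 bA] ab; have := sep _ _ aA bA ab; case/andP: aA => a0 aA.
  rewrite (exprD _ (k + k) u); set K2 := 2 ^+ (k + k).
  have K20 : 0 < K2 by rewrite exprn_gt0.
  have nM : `|G a - G b| <= 2 ^+ u * `|G a - G b|.
    by rewrite ler_peMl// exprn_ege1// ler1n.
  have := dist_le_scales c I (G a) (G b); rewrite le_max => /orP[h|].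
    by move/le_trans; apply; rewrite -mulrA ler_pM2l.
  rewrite le_max => /orP[h|h].
    move/le_trans; apply; rewrite -mulrA ler_pM2l//; apply: le_trans h _.
    apply: le_trans (bump_dist_le_tent _ _ _ _) _.
    by rewrite !notent// addr0 ge_max nM (le_trans _ nM).
  (* The bumps after [I.+1] are lower than the scale of the image. *)
  move=> rd; have : r <= K2 * (2 * (mag I.+2)^-1).
    by apply: le_trans rd _; rewrite ler_pM2l.
  rewrite leNgt => /negP[]; apply: lt_le_trans r_big.
  rewrite mulrA -exprSr ltr_pdivrMr ?mag_gt0// mulrC ltr_pdivlMr ?exprn_gt0//.
  rewrite -exprD /mag ltr_eXn2l ?ltr1n// factS -/w; nia.
have : (A <= (2 ^ (3 * k + u + 2)).-1.+1 ^ m)%N.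
  apply: (@packing _ m _ _ (fun a : 'I_A => G a.+1) (F 0) (2 ^+ k * r)
     (r / 2 ^+ (k + k + u))).
  - by rewrite divr_gt0// exprn_gt0.
  - rewrite prednK ?expn_gt0// natrX mulrAC ltr_pdivlMr ?exprn_gt0//.
    have -> : 2 * (2 ^+ k * r) * 2 ^+ (k + k + u) =
        r * 2 ^+ (k.+1 + (k + k + u)).
      by rewrite (exprD _ k.+1) exprS; ring.
    rewrite ltr_pM2l// ltr_eXn2l ?ltr1n//; lia.
  - by move=> a; rewrite distrC; apply: le_trans (norm_le_dist c _ _) (far _ _).
  - move=> a b /eqP ab; rewrite ler_pdivrMr ?exprn_gt0// mulrC sepE ?ltn_ord//.
    by move=> [/val_inj].
rewrite prednK ?expn_gt0// -expnM leq_exp2l// => /=; nia.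
Qed.
End Centre.

(** * Metric spaces and quasisymmetric maps *)

Lemma near_mdist (R : realType) (Y : metricType R) (x : Y) (e : R) : 0 < e ->
  \forall y \near x, mdist x y < e.
Proof. by move=> e0; have := nbhsx_ballx x e e0; rewrite ballEmdist. Qed.

Lemma contraction_continuous (R : realType) (V : normedModType R)
    (Y : metricType R) (h : Y -> V) :
  (forall x y, `|h x - h y| <= mdist x y) -> continuous h.
Proof.
move=> hh x; apply/cvgrPdist_lt => e e0; apply: filterS (near_mdist x e0) => y.
exact: le_lt_trans.
Qed.

Lemma continuous_mdist (R : realType) (X Y : metricType R) (f : X -> Y) :
  continuous f -> forall x eps, 0 < eps ->
  exists2 d, 0 < d & forall y, mdist x y < d -> mdist (f x) (f y) < eps.
Proof.
move=> cf x eps eps0.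
have /nbhs_ballP[d /= d0 dE] := cf x _ (nbhsx_ballx (f x) eps eps0).
by exists d => // y xy; have := dE y; rewrite /= !ballEmdist/=; exact.
Qed.

(** Only the value [eta 2] of the gauge matters below: applied repeatedly, the
comparison at ratio 2 yields everything else. Dropping the distinctness of the
points is what makes it convenient to apply. *)
Lemma quasisymmetric_weak (R : realType) (X Y : metricType R) (B : set Y)
    (f : X -> Y) : quasisymmetric_onto B f ->
  exists k, forall x y z, mdist x y <= 2 * mdist y z ->
    mdist (f x) (f y) <= 2 ^+ k * mdist (f y) (f z).
Proof.
move=> [[_ _ [g [fK _]]] [eta [[_ eta_incr] fqs]]].
pose k := Num.truncn (eta 2); exists k => x y z xy.
have k1 : 1 <= 2 ^+ k :> R by rewrite exprn_ege1// ler1n.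
have etak : eta 2 <= 2 ^+ k.
  by apply: le_trans (ltW (truncnS_gt _)) _; rewrite -natrX ler_nat ltn_expl.
have [yz|/eqP yz] := eqVneq y z.
  rewrite yz mdistxx mulr0 in xy *.
  rewrite (_ : x = z) ?mdistxx//; apply: mdist_positivity.
  by apply/eqP; rewrite eq_le xy mdist_ge0.
have [->|/eqP nxy] := eqVneq x y.
  by rewrite mdistxx mulr_ge0 ?mdist_ge0// (le_trans _ k1).
have [->|/eqP xz] := eqVneq x z.
  by rewrite metric_sym ler_peMl ?mdist_ge0.
have yz0 : 0 < mdist y z by rewrite mdist_gt0; apply/eqP.
have fyz0 : 0 < mdist (f y) (f z).
  by rewrite mdist_gt0; apply/eqP => /(can_inj fK).
rewrite -ler_pdivrMr//; apply: le_trans (fqs _ _ _ nxy yz xz) _.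
apply: le_trans etak.
have : mdist x y / mdist y z <= 2 by rewrite ler_pdivrMr.
rewrite le_eqVlt => /predU1P[->//|r2].
by apply: ltW; apply: eta_incr r2; rewrite divr_ge0 ?mdist_ge0.
Qed.

(** * The space carrying the bump metric *)

(** An alias, so that the bump metric does not compete with the structures that
subtypes of [V] already carry. *)
Definition bump_space (R : realType) (V : normedModType R) (c : nat -> V)
  (S : set V) := set_type S.

Section BumpSpace.
Context {R : realType} {V : normedModType R}.
Variables (c : nat -> V) (S : set V).
Local Notation X := (bump_space c S).

HB.instance Definition _ := Choice.copy X (set_type S).

Definition point (x : X) : V := \val (x : set_type S).

Lemma point_inj : injective point.
Proof. exact: val_inj. Qed.

Lemma pointP (x : X) : S (point x).
Proof. exact: set_valP. Qed.

Definition point_in (x0 : X) (v : V) : X := match pselect (S v) with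
  | left h => exist (fun v => v \in S) v (mem_set h)
  | right _ => x0 end.

Lemma point_inK x0 v : S v -> point (point_in x0 v) = v.
Proof. by rewrite /point_in; case: pselect. Qed.

Definition space_dist (x y : X) : R := dist c (point x) (point y).

Let space_dist_positive (x y : X) : space_dist x y = 0 -> x = y.
Proof. by move/dist_positive/point_inj. Qed.

HB.instance Definition _ := @isMetric.Build R X space_dist
  (fun x => distxx c (point x)) space_dist_positive
  (fun x y => dist_sym c (point x) (point y))
  (fun y x z => dist_triangle c (point y) (point x) (point z)).

Lemma mdistE (x y : X) : mdist x y = dist c (point x) (point y).
Proof. by []. Qed.

(** Bumps being lower and lower, only finitely many matter at a given scale: the
bump metric induces the topology of the norm. *)
Lemma dist_near (x : V) (e : R) : 0 < e ->
   exists2 d, 0 < d & forall y, `|x - y| < d -> dist c x y < e.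
Proof.
move=> e0; have [I IE] : exists I, 2 ^- I <= e / 4.
  by apply: ex_small_pow2; rewrite divr_gt0.
exists (e / mag I); first by rewrite divr_gt0// mag_gt0.
move=> y; rewrite ltr_pdivlMr ?mag_gt0// mulrC => h.
apply: le_lt_trans (dist_le_scale c I x y) _; rewrite gt_max h/=.
have : (mag I.+1)^-1 <= 2 ^- I :> R.
  by apply: ler_pow2V; rewrite factS; have := fact_gt0 I; nia.
lra.
Qed.

Lemma bump_space_homeomorphic (x0 : X) : homeomorphic_to X S.
Proof.
pose g := point_in x0; have gK v : S v -> point (g v) = v by exact: point_inK.
exists point; split.
- split; first by move=> x _; exact: pointP.
  + by move=> x y _ _; exact: point_inj.
  + by move=> v Sv; exists (g v) => //; exact: gK.
- by apply: contraction_continuous => x y; exact: norm_le_dist.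
- exists g; split.
    by move=> x; apply: point_inj; rewrite gK//; exact: pointP.
  apply/subspace_continuousP => v Sv.
  apply/metricType_numDomainType.cvgrPdist_lt => e e0.
  have [d d0 dE] := dist_near v e0.
  rewrite near_withinE; have := nbhsx_ballx v d d0.
  by apply: filterS => w; rewrite -ball_normE/= => /dE h Sw; rewrite mdistE !gK.
Qed.

End BumpSpace.

(** * Rigidity *)

Section Rigid.
Context {R : realType} {m : nat}.
Local Notation V := 'rV[R]_m.
Variables (c : nat -> V) (S : set V).

Definition edge_start (p : V) := exists (e : V) l, `|e| = 1 /\
   forall t, 0 <= t <= 2 ^- l -> S (p + t *: e).

Lemma qs_fixes_edge_start (f : bump_space c S -> bump_space c S)
    (P : bump_space c S) :
  quasisymmetric_embedding f -> edge_start (point P) ->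
  (forall J, exists2 I, (J <= I)%N & c I.+1 = point P) -> f P = P.
Proof.
move=> qf; set p := point P => -[e [l [e1 Se]]] often.
have [k wk] := quasisymmetric_weak qf; case: qf => -[_ cf [f' [fK _]]] _.
pose gam (t : R) : bump_space c S := point_in P (p + t *: e).
have gamE t : 0 <= t <= 2 ^- l -> point (gam t) = p + t *: e.
  by move=> /Se; exact: point_inK.
have l0 : 0 <= (0 : R) <= 2 ^- l by rewrite lexx invr_ge0 exprn_ge0.
have lV j : (l <= j)%N -> 0 <= (2 ^- j : R) <= 2 ^- l.
  by move=> lj; rewrite invr_ge0 exprn_ge0//= ler_pow2V.
have gam0 : gam 0 = P by apply: point_inj; rewrite gamE// scale0r addr0.
apply: point_inj; rewrite -{1}gam0.
apply: (@centre_fixed _ _ c p e l k (fun t => point (f (gam t)))) => //.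
- by move=> s t u ls lt lu; rewrite -!gamE//; exact: wk.
- move=> /point_inj /(can_inj fK) /(congr1 (@point _ _ c S)).
  rewrite !gamE ?lV// scale0r => /addrI/esym/eqP.
  have e0 : e != 0 by rewrite -normr_eq0 e1 oner_eq0.
  by rewrite scaler_eq0 invr_eq0 expf_eq0 pnatr_eq0 (negbTE e0) andbF.
- move=> eps eps0; rewrite gam0.
  have [d d0 dE] := continuous_mdist cf P eps0.
  have [d' d'0 d'E] := dist_near c p d0.
  have [i iE] : exists i, 2 ^- i <= d' / 2.
    by apply: ex_small_pow2; rewrite divr_gt0.
  exists (l + i)%N => [|j lij]; first exact: leq_addr.
  apply: dE; rewrite mdistE -/p gamE; last by apply: lV; lia.
  apply: d'E; rewrite opprD addNKr normrN normrZ e1 mulr1.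
  rewrite ger0_norm ?invr_ge0 ?exprn_ge0//.
  have : 2 ^- j <= 2 ^- i :> R by apply: ler_pow2V; lia.
  lra.
Qed.

(** The embedding fixes a dense set, so it is the identity. *)
Lemma bump_space_coHopfian :
  (forall x eps, S x -> 0 < eps ->
     exists p, [/\ S p, `|x - p| < eps, edge_start p &
     forall J, exists2 I, (J <= I)%N & c I.+1 = p]) ->
  qs_coHopfian (bump_space c S).
Proof.
move=> dense f qf; have [[_ cf _] _] := qf.
suff fE x : f x = x by apply/seteqP; split => // x _; exists x.
apply: mdist_positivity; apply/eqP; rewrite eq_le mdist_ge0 andbT.
apply/ler_addgt0Pl => eps eps0; rewrite addr0.
have e20 : 0 < eps / 2 by rewrite divr_gt0.
have [d d0 dE] := continuous_mdist cf x e20.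
have [d1 d10 d1E] := dist_near c (point x) d0.
have [d2 d20 d2E] := dist_near c (point x) e20.
have m0 : 0 < Num.min d1 d2 by rewrite lt_min d10.
have [p [Sp]] := dense _ _ (pointP x) m0.
rewrite lt_min => /andP[/d1E xp1 /d2E xp2] hp often.
pose P := point_in x p; have pE : point P = p by exact: point_inK.
rewrite -pE in xp1 xp2 hp often.
have fP := qs_fixes_edge_start qf hp often.
apply: le_trans (metric_triangle _ (f P) _) _; rewrite {2}fP (metric_sym P).
have := dE P xp1; have : mdist x P < eps / 2 by [].
lra.
Qed.
End Rigid.

(** * Cubes and edges of the Sierpinski space *)

Section Sierpinski.
Context {R : realType} {m : nat}.
Local Notation V := 'rV[R]_m.
Implicit Types (a b x : V) (i k : nat).

Definition triadic i (z : {ffun 'I_m -> nat}) : V := \row_j ((z j)%:R / 3 ^+ i).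

Lemma pow3VS i : 3 ^- i = 3 * 3 ^- i.+1 :> R.
Proof. by rewrite exprS invfM mulVKf. Qed.

Lemma pow3V_gt0 i : 0 < 3 ^- i :> R.
Proof. by rewrite invr_gt0 exprn_gt0. Qed.

Lemma natr3D (p q : nat) : (3 * p + q)%:R = 3 * p%:R + q%:R :> R.
Proof. by rewrite natrD natrM. Qed.

Lemma corner_triadic i a : sierpinski_corners i a -> exists z, a = triadic i z.
Proof.
elim: i a => [|i IH] a /=.
  by move=> ->; exists [ffun=> 0%N]; apply/rowP => j; rewrite !mxE ffunE mul0r.
move=> [b /IH[z ->]] [d _ <-]; exists [ffun j => (3 * z j + d j)%N].
by apply/rowP => j; rewrite !mxE ffunE (pow3VS i) natr3D; ring.
Qed.

Lemma ltn_scaled i (p q : nat) :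
  p%:R * 3 ^- i < q%:R * 3 ^- i :> R -> (p < q)%N.
Proof. by rewrite ltr_pM2r ?pow3V_gt0// ltr_nat. Qed.

Lemma open_center_scaled i (z : {ffun 'I_m -> nat}) x j :
  open_cube (triadic i z + const_mx (3 ^- i.+1)) (3 ^- i.+1) x ->
  (3 * z j + 1)%:R * 3 ^- i.+1 < x 0 j < (3 * z j + 2)%:R * 3 ^- i.+1.
Proof.
by move=> /(_ j); rewrite !mxE (pow3VS i) !natr3D; lra.
Qed.

(** A kept cube has a digit other than 1 in some coordinate [j0]. If it met a
removed cube of the same generation, comparing integer positions along [j0]
would force that digit to be 1. *)
Lemma closed_cube_stage i a : sierpinski_corners i a ->
  closed_cube a (3 ^- i) `<=` sierpinski_stage i.
Proof.
elim: i a => [|i IH] a /=; first by move=> ->; rewrite expr0 invr1.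
move=> [b cb] [d [j0 dj0] <-] x xa; split.
  apply: (IH b cb) => j; have := xa j; rewrite !mxE (pow3VS i).
  have : (d j)%:R * 3 ^- i.+1 <= 2 * 3 ^- i.+1 :> R.
    by rewrite ler_pM2r ?pow3V_gt0// ler_nat -ltnS ltn_ord.
  have : 0 <= (d j)%:R * 3 ^- i.+1 :> R by rewrite mulr_ge0// ltW ?pow3V_gt0.
  lra.
move=> [b' /corner_triadic[w ->]] /open_center_scaled => /(_ j0) xw.
have [z bz] := corner_triadic cb.
have := xa j0; rewrite bz !mxE (pow3VS i) => xz.
have h1 : ((3 * w j0 + 1) < (3 * z j0 + (d j0 + 1)))%N.
  by apply: (@ltn_scaled i.+1); rewrite !natr3D ?natrD in xw *; lra.
have h2 : ((3 * z j0 + d j0) < (3 * w j0 + 2))%N.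
  by apply: (@ltn_scaled i.+1); rewrite !natr3D ?natrD in xw *; lra.
by apply: dj0; have := ltn_ord (d j0); lia.
Qed.

Lemma stage_closed_cube i x : sierpinski_stage i x ->
  exists2 a, sierpinski_corners i a & closed_cube a (3 ^- i) x.
Proof.
elim: i => [|i IH] /=; first by exists 0 => //; rewrite expr0 invr1.
move=> [/IH[a ca xa] xN].
set s : R := 3 ^- i.+1.
(* Ties go to the digits 0 and 2, so that all digits are 1 only strictly inside
   the central cube. *)
pose dig j : nat := if x 0 j <= a 0 j + s then 0
   else if x 0 j < a 0 j + 2 * s then 1 else 2.
have dig3 j : (dig j < 3)%N by rewrite /dig; case: ifP => // _; case: ifP.
pose d : {ffun 'I_m -> 'I_3} := [ffun j => Ordinal (dig3 j)].
exists (a + \row_j ((d j : nat)%:R / 3 ^+ i.+1)).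
  exists a => //; exists d => //=; apply: contrapT => dN; apply: xN.
  exists a => // j; have : dig j = 1%N.
    by apply: contrapT => h; apply: dN; exists j; rewrite ffunE.
  rewrite !mxE -/s /dig; case: ifP => // h1; case: ifP => // h2 _.
  by rewrite ltNge h1/=; lra.
move=> j; rewrite !mxE ffunE/= -/s; have := xa j; rewrite (pow3VS i) -/s /dig.
case: ifP => [h|/negbT]; first by rewrite mul0r; lra.
rewrite -ltNge => h; case: ifP => [h2|/negbT]; first lra.
by rewrite -leNgt; lra.
Qed.

Lemma stage_decreasing i k : (i <= k)%N ->
  @sierpinski_stage R m k `<=` sierpinski_stage i.
Proof.
elim: k => [|k IH]; first by rewrite leqn0 => /eqP ->.
by rewrite leq_eqVlt => /predU1P[->//|/IH ik] x [/ik].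
Qed.

(** Cubes removed after stage [i] avoid the hyperplanes of the grid of mesh
[3 ^- i]. An edge lies in such a hyperplane as soon as there is a second
coordinate [j1]: in ambient dimension 1 the space is totally disconnected. *)
Lemma edge_stage (j0 j1 : 'I_m) i a t k : j0 != j1 -> sierpinski_corners i a ->
  0 <= t <= 3 ^- i -> sierpinski_stage k (a + t *: delta_mx 0 j0).
Proof.
move=> j01 ca t01; set x := a + _.
have xi : sierpinski_stage i x.
  apply: closed_cube_stage ca _ _ => j; rewrite !mxE eqxx/=.
  case: eqP => _; rewrite ?mulr1 ?mulr0; have := pow3V_gt0 i; lra.
have [ki|/ltnW] := leqP k i; first exact: stage_decreasing xi.
elim: k => [|k IH]; first by rewrite leqn0 => /eqP i0; move: xi; rewrite i0.
rewrite leq_eqVlt => /predU1P[<-//|]; rewrite ltnS => ik.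
split; first exact: IH.
have [z az] := corner_triadic ca.
move=> [b /corner_triadic[w ->]] /open_center_scaled => /(_ j1).
have -> : x 0 j1 = (3 * (3 ^ (k - i) * z j1))%:R * 3 ^- k.+1.
  rewrite /x az !mxE eq_sym (negbTE j01) andbF mulr0 addr0.
  rewrite -{2}(subnK ik) -addSn exprD exprS !natrM natrX.
  by field; rewrite !expf_neq0.
by move=> /andP[/ltn_scaled ? /ltn_scaled ?]; lia.
Qed.

Lemma norm_delta_row (j : 'I_m) : `|delta_mx 0 j : V| = 1.
Proof.
apply/eqP; rewrite eq_le norm_le_entries//=; last first.
  by move=> k; rewrite mxE eqxx/=; case: eqP => _; rewrite ?normr1 ?normr0.
by have := entry_le_norm (delta_mx 0 j : V) j; rewrite mxE !eqxx normr1.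
Qed.

(** Every triadic point has to be the centre of infinitely many bumps; the
2-adic valuation takes each value infinitely often. *)
Definition schedule (i : nat) : V :=
  if unpickle (logn 2 i) is Some (k, z) then triadic k z else 0.

Lemma schedule_often k z J :
  exists2 I, (J <= I)%N & schedule I.+1 = triadic k z.
Proof.
pose q := pickle (k, z).
have q0 : (0 < 2 ^ q * J.*2.+1)%N by rewrite muln_gt0 expn_gt0.
exists (2 ^ q * J.*2.+1).-1; last first.
  rewrite /schedule prednK// lognM ?expn_gt0// pfactorK//.
  by rewrite logn_coprime ?addn0 ?pickleK// coprime2n /= odd_double.
have : (0 < 2 ^ q)%N by rewrite expn_gt0.
by rewrite -muln2; nia.
Qed.

End Sierpinski.

Theorem theorem1p4 (R : realType) (n : nat) (hn : (1 <= n)%N) :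
  exists X : metricType R,
    homeomorphic_to X (sierpinski_space R n) /\ qs_coHopfian X.
Proof.
case: n hn => // n _; set S := sierpinski_space R n.+1.
have j01 : (ord0 : 'I_n.+2) != ord_max by rewrite -val_eqE.
have corner_edge i a t : sierpinski_corners i a -> 0 <= t <= 3 ^- i ->
    S (a + t *: delta_mx 0 ord0).
  by move=> ca t01 k _; exact: edge_stage j01 ca t01.
have corner_in i a : sierpinski_corners i a -> S a.
  move=> ca; have := @corner_edge _ _ 0 ca; rewrite scale0r addr0.
  by apply; rewrite lexx ltW ?pow3V_gt0.
have S0 : S 0 by apply: (corner_in 0%N).
exists (bump_space schedule S); split.
  apply: bump_space_homeomorphic.
  exact: (exist (fun v => v \in S) 0 (mem_set S0)).
apply: bump_space_coHopfian => x eps Sx eps0.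
have [i ieps] := ex_small_pow2 eps0.
have [a ca xa] := stage_closed_cube (Sx i.+1 I).
have [z az] := corner_triadic ca.
exists a; split.
- exact: corner_in ca.
- apply: norm_lt_entries => // j; have := xa j.
  have : 3 ^- i.+1 < 2 ^- i :> R.
    rewrite ltf_pV2 ?posrE ?exprn_gt0//.
    apply: (@le_lt_trans _ _ (3 ^+ i)); last by rewrite ltr_eXn2l// ltr1n.
    by rewrite lerXn2r ?nnegrE// ler_nat.
  rewrite !mxE => ? /andP[h1 h2]; rewrite ger0_norm; lra.
- have [l ll] := ex_small_pow2 (pow3V_gt0 (R:=R) i.+1).
  exists (delta_mx 0 ord0), l; split; last first.
    move=> t /andP[t0 tl]; apply: corner_edge ca _.
    by rewrite t0 (le_trans tl).
  exact: norm_delta_row.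
- by rewrite az; exact: schedule_often.
Qed.
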